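(* Let $u:A\rightarrow B$ be a ring morphism. There exists a greatest (with respect to inclusion) subring $C$ of $B$ containing $u(A)$ such that $u:A\rightarrow C$ is a strong PSI-morphism.
   Context: All rings are commutative and unitary, and ring morphisms are unitary; subrings contain the identity. For $P\in\mathrm{Spec}(A)$, $k_A(P)=A_P/PA_P$ denotes the residue field of $A$ at $P$. A ring morphism $A\to C$ is a strong PSI-morphism if for every $P\in\mathrm{Spec}(A)$ with $k_A(P)\otimes_A C\neq 0$, the canonical map $k_A(P)\to k_A(P)\otimes_A C$ is an isomorphism. *)

(* Defs.v *)
From HB Require Import structures.
From mathcomp Require Import all_boot all_algebra.
From mathcomp Require Import boolp.
From mathcomp Require Import ring.

Set Implicit Arguments.
Unset Strict Implicit.
Unset Printing Implicit Defensive.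

Import GRing.Theory.
Local Open Scope ring_scope.
Local Open Scope quotient_scope.

(* Rings are [comPzRingType]: the zero ring is allowed.  The library's
   [prime_idealr] is only available over nonzero rings, hence this version.
   Boolean predicates describe all subsets, by classical logic ([asbool]). *)
Record Spec (A : comPzRingType) := MkSpec {
  Spec_pred :> {pred A};
  Spec0 : 0 \in Spec_pred;
  Spec1 : 1 \notin Spec_pred;
  SpecD : {in Spec_pred &, forall u v, u + v \in Spec_pred};
  SpecM : forall a, {in Spec_pred, forall u, a * u \in Spec_pred};
  Spec_prime : forall u v, u * v \in Spec_pred ->
    (u \in Spec_pred) || (v \in Spec_pred)
}.

Section Localization.
Variables (A : comPzRingType) (P : Spec A).

Definition denom := {s : A | s \notin P}.
HB.instance Definition _ := Choice.on denom.

Lemma denom_mul_proof (s t : denom) : sval s * sval t \notin P.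
Proof.
by apply/negP => /Spec_prime; rewrite (negPf (svalP s)) (negPf (svalP t)).
Qed.

Definition denom1 : denom := exist _ 1 (Spec1 P).
Definition denom_mul (s t : denom) : denom :=
  exist _ (sval s * sval t) (denom_mul_proof s t).

Definition frac_eq (x y : A * denom) : bool :=
  `[< exists t : denom,
        sval t * (x.1 * sval y.2) = sval t * (y.1 * sval x.2) >].

Lemma frac_eq_is_equiv : equiv_class_of frac_eq.
Proof.
split=> [x|x y|y x z].
- by apply/asboolP; exists denom1.
- by apply/asboolP/asboolP => -[t e]; exists t.
- move=> /asboolP[t e] /asboolP[r f]; apply/asboolP.
  exists (denom_mul (denom_mul t r) y.2) => /=.
  transitivity (sval r * sval z.2 * (sval t * (x.1 * sval y.2))); first by ring.
  rewrite e.
  transitivity (sval t * sval x.2 * (sval r * (y.1 * sval z.2))); first by ring.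
  by rewrite f; ring.
Qed.

Canonical frac_eq_equiv := EquivRelPack frac_eq_is_equiv.
Canonical frac_eq_encModRel := defaultEncModRel frac_eq.

(* The localization A_P. *)
Definition loc := {eq_quot frac_eq}.
HB.instance Definition _ := Choice.on loc.
HB.instance Definition _ : EqQuotient _ frac_eq loc := EqQuotient.on loc.

Definition mkfrac (a : A) (s : denom) : loc := \pi_loc (a, s).

Lemma mkfrac_eq a s b t :
  mkfrac a s = mkfrac b t <->
  exists r : denom, sval r * (a * sval t) = sval r * (b * sval s).
Proof.
split; first by move/eqmodP/asboolP.
by move=> h; apply/eqmodP/asboolP.
Qed.

Lemma locP (x : loc) : exists a s, x = mkfrac a s.
Proof.
by case e: (repr x) => [a s]; exists a, s; rewrite /mkfrac -e reprK.
Qed.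

Definition loc_zero : loc := mkfrac 0 denom1.
Definition loc_one : loc := mkfrac 1 denom1.
Definition loc_opp (x : loc) : loc := mkfrac (- (repr x).1) (repr x).2.
Definition loc_add (x y : loc) : loc :=
  mkfrac ((repr x).1 * sval (repr y).2 + (repr y).1 * sval (repr x).2)
         (denom_mul (repr x).2 (repr y).2).
Definition loc_mul (x y : loc) : loc :=
  mkfrac ((repr x).1 * (repr y).1) (denom_mul (repr x).2 (repr y).2).

Lemma repr_mkfrac a s : exists r : denom,
  sval r * ((repr (mkfrac a s)).1 * sval s) =
  sval r * (a * sval (repr (mkfrac a s)).2).
Proof.
apply/mkfrac_eq.
by rewrite {1}/mkfrac -surjective_pairing reprK.
Qed.

Lemma loc_oppE a s : loc_opp (mkfrac a s) = mkfrac (- a) s.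
Proof.
have [r e] := repr_mkfrac a s.
by apply/mkfrac_eq; exists r; rewrite !mulNr !mulrN e.
Qed.

Lemma loc_addE a s b t : loc_add (mkfrac a s) (mkfrac b t) =
  mkfrac (a * sval t + b * sval s) (denom_mul s t).
Proof.
have [r e] := repr_mkfrac a s; have [q f] := repr_mkfrac b t.
apply/mkfrac_eq; exists (denom_mul r q) => /=.
move: (repr (mkfrac a s)) (repr (mkfrac b t)) e f => [x1 x2] [y1 y2] /= e f.
transitivity (sval t * sval q * sval y2 * (sval r * (x1 * sval s)) +
  sval s * sval r * sval x2 * (sval q * (y1 * sval t))); first by ring.
by rewrite e f; ring.
Qed.

Lemma loc_mulE a s b t : loc_mul (mkfrac a s) (mkfrac b t) =
  mkfrac (a * b) (denom_mul s t).
Proof.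
have [r e] := repr_mkfrac a s; have [q f] := repr_mkfrac b t.
apply/mkfrac_eq; exists (denom_mul r q) => /=.
move: (repr (mkfrac a s)) (repr (mkfrac b t)) e f => [x1 x2] [y1 y2] /= e f.
transitivity ((sval r * (x1 * sval s)) * (sval q * (y1 * sval t))); first by ring.
by rewrite e f; ring.
Qed.

Lemma loc_addA : associative loc_add.
Proof.
move=> x y z; have [a [s ->]] := locP x; have [b [t ->]] := locP y.
have [c [r ->]] := locP z; rewrite !loc_addE.
by apply/mkfrac_eq; exists denom1 => /=; ring.
Qed.

Lemma loc_addC : commutative loc_add.
Proof.
move=> x y; have [a [s ->]] := locP x; have [b [t ->]] := locP y.
by rewrite !loc_addE; apply/mkfrac_eq; exists denom1 => /=; ring.
Qed.

Lemma loc_add0 : left_id loc_zero loc_add.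
Proof.
move=> x; have [a [s ->]] := locP x.
by rewrite loc_addE; apply/mkfrac_eq; exists denom1 => /=; ring.
Qed.

Lemma loc_addN : left_inverse loc_zero loc_opp loc_add.
Proof.
move=> x; have [a [s ->]] := locP x.
by rewrite loc_oppE loc_addE; apply/mkfrac_eq; exists denom1 => /=; ring.
Qed.

HB.instance Definition _ :=
  GRing.isZmodule.Build loc loc_addA loc_addC loc_add0 loc_addN.

Lemma loc_mulA : associative loc_mul.
Proof.
move=> x y z; have [a [s ->]] := locP x; have [b [t ->]] := locP y.
have [c [r ->]] := locP z; rewrite !loc_mulE.
by apply/mkfrac_eq; exists denom1 => /=; ring.
Qed.

Lemma loc_mulC : commutative loc_mul.
Proof.
move=> x y; have [a [s ->]] := locP x; have [b [t ->]] := locP y.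
by rewrite !loc_mulE; apply/mkfrac_eq; exists denom1 => /=; ring.
Qed.

Lemma loc_mul1 : left_id loc_one loc_mul.
Proof.
move=> x; have [a [s ->]] := locP x.
by rewrite loc_mulE; apply/mkfrac_eq; exists denom1 => /=; ring.
Qed.

Lemma loc_mulD : left_distributive loc_mul loc_add.
Proof.
move=> x y z; have [a [s ->]] := locP x; have [b [t ->]] := locP y.
have [c [r ->]] := locP z; rewrite (loc_addE a s b t) (loc_mulE a s c r) (loc_mulE b t c r).
rewrite loc_mulE loc_addE.
by apply/mkfrac_eq; exists denom1 => /=; ring.
Qed.

Lemma loc_1neq0 : loc_one != 0.
Proof.
apply/eqP => /mkfrac_eq[r] /=; rewrite !mulr1 mulr0 => r0.
by have := svalP r; rewrite /= r0 Spec0.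
Qed.

HB.instance Definition _ := GRing.Zmodule_isComNzRing.Build loc
  loc_mulA loc_mulC loc_mul1 loc_mulD loc_1neq0.

Lemma mkfracD a s b t : mkfrac a s + mkfrac b t =
  mkfrac (a * sval t + b * sval s) (denom_mul s t).
Proof. exact: loc_addE. Qed.

Lemma mkfracM a s b t :
  mkfrac a s * mkfrac b t = mkfrac (a * b) (denom_mul s t).
Proof. exact: loc_mulE. Qed.

Definition to_loc (a : A) : loc := mkfrac a denom1.

Lemma to_loc_is_zmod_morphism : zmod_morphism to_loc.
Proof.
move=> a b; rewrite [RHS]/GRing.add /= [X in loc_add _ X]loc_oppE loc_addE.
by apply/mkfrac_eq; exists denom1 => /=; ring.
Qed.

Lemma to_loc_is_monoid_morphism : monoid_morphism to_loc.
Proof.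
split=> // a b; rewrite [RHS]loc_mulE.
by apply/mkfrac_eq; exists denom1 => /=; ring.
Qed.

HB.instance Definition _ :=
  GRing.isZmodMorphism.Build A loc to_loc to_loc_is_zmod_morphism.
HB.instance Definition _ :=
  GRing.isMonoidMorphism.Build A loc to_loc to_loc_is_monoid_morphism.

(* The maximal ideal PA_P. *)
Definition loc_max : {pred loc} :=
  fun x => `[< exists a s, a \in P /\ x = mkfrac a s >].

Lemma loc_maxE a s : (mkfrac a s \in loc_max) = (a \in P).
Proof.
apply/asboolP/idP => [[b [t [Pb /mkfrac_eq[r e]]]]|Pa]; last by exists a, s.
have /Spec_prime/orP[|] : sval (denom_mul r t) * a \in P.
- rewrite (_ : _ * _ = sval r * (a * sval t)); last by rewrite /=; ring.
  by rewrite e mulrA mulrAC; apply: SpecM.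
- by rewrite (negPf (svalP (denom_mul r t))).
- by [].
Qed.

Lemma loc_max_idealr : idealr_closed loc_max.
Proof.
split; first by rewrite [0]/(mkfrac _ _) loc_maxE Spec0.
  by rewrite [1]/(mkfrac _ _) loc_maxE Spec1.
move=> x y z; have [a [s ->]] := locP x; have [b [t ->]] := locP y.
have [c [r ->]] := locP z; rewrite mkfracM mkfracD.
rewrite !loc_maxE => Pb Pc; rewrite SpecD //.
  by rewrite mulrAC SpecM.
by rewrite mulrC SpecM.
Qed.

HB.instance Definition _ := isIdealr.Build loc loc_max loc_max_idealr.

Definition residue_field := {ideal_quot loc_max}.
HB.instance Definition _ := GRing.ComNzRing.on residue_field.

Definition to_residue : A -> residue_field := \pi_residue_field \o to_loc.
HB.instance Definition _ := GRing.RMorphism.on to_residue.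

Lemma residue_inv_ex (x : residue_field) :
  exists y, if x == 0 then y = 0 else y * x = 1.
Proof.
case: eqP => [_|x0]; first by exists 0.
have [a [s e]] := locP (repr x).
have nPa : a \notin P.
  apply/negP => Pa; apply: x0; rewrite -[x]reprK e -[0](rmorph0 \pi_residue_field).
  by apply/eqP; rewrite -Quotient.idealrBE subr0 loc_maxE.
pose t : denom := exist _ a nPa.
exists (\pi_residue_field (mkfrac (sval s) t)); rewrite -[x in LHS]reprK e -rmorphM.
rewrite mkfracM -[1](rmorph1 \pi_residue_field); congr (\pi_residue_field _).
by apply/mkfrac_eq; exists denom1 => /=; ring.
Qed.

Definition residue_inv x := sval (cid (residue_inv_ex x)).

Lemma residue_mulVf x : x != 0 -> residue_inv x * x = 1.
Proof. by rewrite /residue_inv; case: cid => y /=; case: ifP. Qed.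

Lemma residue_invr0 : residue_inv 0 = 0.
Proof. by rewrite /residue_inv; case: cid => y /=; rewrite eqxx. Qed.

HB.instance Definition _ :=
  GRing.ComNzRing_isField.Build residue_field residue_mulVf residue_invr0.

End Localization.

(* The tensor product over A of the A-algebras K and C.  A list of pairs (x, y)
   stands for the sum of the pure tensors of x and y.  No relation for opposites
   is needed: -(x, y) is (-x, y), by [TAddl] and [TZero]. *)
Section Tensor.
Variables (A K C : comPzRingType).
Variables (i : {rmorphism A -> K}) (j : {rmorphism A -> C}).

Inductive tensor_rel : seq (K * C) -> seq (K * C) -> Prop :=
| TRefl s : tensor_rel s s
| TSym s t : tensor_rel s t -> tensor_rel t s
| TTrans s t r : tensor_rel s t -> tensor_rel t r -> tensor_rel s r
| TCat s s' t t' :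
    tensor_rel s s' -> tensor_rel t t' -> tensor_rel (s ++ t) (s' ++ t')
| TComm s t : tensor_rel (s ++ t) (t ++ s)
| TZero y : tensor_rel [:: (0, y)] [::]
| TAddl x x' y : tensor_rel [:: (x + x', y)] [:: (x, y); (x', y)]
| TAddr x y y' : tensor_rel [:: (x, y + y')] [:: (x, y); (x, y')]
| TScale a x y : tensor_rel [:: (i a * x, y)] [:: (x, j a * y)].

Definition tensor_eq (s t : seq (K * C)) : bool := `[< tensor_rel s t >].

Lemma tensor_eq_is_equiv : equiv_class_of tensor_eq.
Proof.
split=> [s|s t|t s r]; first by apply/asboolP; constructor.
- by apply/asboolP/asboolP; apply: TSym.
- by move=> /asboolP st /asboolP tr; apply/asboolP; apply: TTrans tr.
Qed.

Canonical tensor_eq_equiv := EquivRelPack tensor_eq_is_equiv.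
Canonical tensor_eq_encModRel := defaultEncModRel tensor_eq.

Definition tensor := {eq_quot tensor_eq}.
HB.instance Definition _ := Choice.on tensor.
HB.instance Definition _ : EqQuotient _ tensor_eq tensor :=
  EqQuotient.on tensor.

Lemma tensor_pi_eq s t : \pi_tensor s = \pi_tensor t <-> tensor_rel s t.
Proof.
split; first by move/eqmodP/asboolP.
by move=> h; apply/eqmodP/asboolP.
Qed.

Lemma tensor_repr s : tensor_rel (repr (\pi_tensor s)) s.
Proof. by apply/tensor_pi_eq; rewrite reprK. Qed.

Definition pure (x : K) (y : C) : tensor := \pi_tensor [:: (x, y)].

Definition tensor_zero : tensor := \pi_tensor [::].
Definition tensor_add (z w : tensor) : tensor := \pi_tensor (repr z ++ repr w).
Definition tensor_opp (z : tensor) : tensor :=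
  \pi_tensor [seq (- p.1, p.2) | p <- repr z].

Lemma tensor_addE s t :
  tensor_add (\pi_tensor s) (\pi_tensor t) = \pi_tensor (s ++ t).
Proof. by apply/tensor_pi_eq; apply: TCat; apply: tensor_repr. Qed.

Lemma tensor_addA : associative tensor_add.
Proof.
move=> x y z; rewrite -[x]reprK -[y]reprK -[z]reprK.
rewrite (tensor_addE (repr y) (repr z)) (tensor_addE (repr x) (repr y)).
by rewrite (tensor_addE (repr x)) (tensor_addE (_ ++ _)) catA.
Qed.

Lemma tensor_addC : commutative tensor_add.
Proof. by move=> x y; apply/tensor_pi_eq; apply: TComm. Qed.

Lemma tensor_add0 : left_id tensor_zero tensor_add.
Proof. by move=> x; rewrite -[x]reprK tensor_addE. Qed.

Lemma tensor_addN : left_inverse tensor_zero tensor_opp tensor_add.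
Proof.
move=> z; rewrite -{2}[z]reprK tensor_addE; apply/tensor_pi_eq.
elim: (repr z) => [|[x y] s IH] /=; first exact: TRefl.
apply: (@TTrans _ ([:: (- x, y); (x, y)] ++ (s ++ [seq (- p.1, p.2) | p <- s]))).
  exact: (TCat (TRefl [:: (- x, y)]) (TComm _ ((x, y) :: s))).
apply: (@TTrans _ ([::] ++ [::])); last exact: TRefl.
apply: TCat; last exact: TTrans (TComm _ _) IH.
by apply: TTrans (TSym (TAddl _ _ _)) _; rewrite addNr; apply: TZero.
Qed.

HB.instance Definition _ := GRing.isZmodule.Build tensor
  tensor_addA tensor_addC tensor_add0 tensor_addN.

Lemma pi_cat s t : \pi_tensor (s ++ t) = \pi_tensor s + \pi_tensor t.
Proof. by rewrite -tensor_addE. Qed.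

Lemma pi_sum s : \pi_tensor s = \sum_(p <- s) pure p.1 p.2.
Proof.
elim: s => [|p s IH]; first by rewrite big_nil.
by rewrite big_cons -IH -pi_cat /=; case: p.
Qed.

Lemma tensor_ind (Q : tensor -> Prop) :
  Q 0 -> (forall z w, Q z -> Q w -> Q (z + w)) ->
  (forall x y, Q (pure x y)) -> forall z, Q z.
Proof.
move=> Q0 QD Qp z; rewrite -[z]reprK pi_sum.
by elim/big_rec: _ => // p w _; apply: QD.
Qed.

Lemma pureDl x x' y : pure (x + x') y = pure x y + pure x' y.
Proof. by rewrite -pi_cat; apply/tensor_pi_eq; apply: TAddl. Qed.

Lemma pureDr x y y' : pure x (y + y') = pure x y + pure x y'.
Proof. by rewrite -pi_cat; apply/tensor_pi_eq; apply: TAddr. Qed.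

Lemma pure_scale a x y : pure (i a * x) y = pure x (j a * y).
Proof. by apply/tensor_pi_eq; apply: TScale. Qed.

Record balanced (M : zmodType) (f : K -> C -> M) : Prop := Balanced {
  balDl : forall x x' y, f (x + x') y = f x y + f x' y;
  balDr : forall x y y', f x (y + y') = f x y + f x y';
  bal_scale : forall a x y, f (i a * x) y = f x (j a * y)
}.

Lemma pure_balanced : balanced pure.
Proof. by split; [exact: pureDl|exact: pureDr|exact: pure_scale]. Qed.

(* Universal property of the tensor product; it serves to define the
   multiplication. *)
Definition tensor_lift (M : zmodType) (f : K -> C -> M) (z : tensor) : M :=
  \sum_(p <- repr z) f p.1 p.2.

Section Lift.
Variables (M : zmodType) (f : K -> C -> M) (fP : balanced f).

Lemma tensor_lift_rel s t : tensor_rel s t ->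
  \sum_(p <- s) f p.1 p.2 = \sum_(p <- t) f p.1 p.2.
Proof.
elim=> {s t} [//|//|s t r _ -> _ -> //|s s' t t' _ e _ e'|s t|y|x x' y|x y y'|a x y].
- by rewrite !big_cat /= e e'.
- by rewrite !big_cat /= addrC.
- rewrite big_seq1 big_nil /=; apply: (addrI (f 0 y)).
  by rewrite -(balDl fP) !addr0.
- by rewrite !big_cons !big_nil !addr0 (balDl fP).
- by rewrite !big_cons !big_nil !addr0 (balDr fP).
- by rewrite !big_seq1 /= (bal_scale fP).
Qed.

Lemma tensor_lift_pi s :
  tensor_lift f (\pi_tensor s) = \sum_(p <- s) f p.1 p.2.
Proof. exact/tensor_lift_rel/tensor_repr. Qed.

Lemma tensor_lift_pure x y : tensor_lift f (pure x y) = f x y.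
Proof. by rewrite tensor_lift_pi big_seq1. Qed.

Lemma tensor_lift0 : tensor_lift f 0 = 0.
Proof. by rewrite -[0 in LHS]/tensor_zero tensor_lift_pi big_nil. Qed.

Lemma tensor_liftD z w :
  tensor_lift f (z + w) = tensor_lift f z + tensor_lift f w.
Proof.
by rewrite -[z]reprK -[w]reprK -pi_cat !tensor_lift_pi big_cat.
Qed.

Lemma tensor_lift_unique (g : tensor -> M) :
  {morph g : z w / z + w} -> (forall x y, g (pure x y) = f x y) ->
  g =1 tensor_lift f.
Proof.
move=> gD gp; elim/tensor_ind => [|z w gz gw|x y].
- by rewrite tensor_lift0; apply: (addrI (g 0)); rewrite -gD !addr0.
- by rewrite gD tensor_liftD gz gw.
- by rewrite gp tensor_lift_pure.
Qed.

End Lift.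

Definition tensor_one : tensor := pure 1 1.
Definition tensor_mul (z w : tensor) : tensor :=
  tensor_lift
    (fun x y => tensor_lift (fun x' y' => pure (x * x') (y * y')) w) z.

Lemma mul_balanced x y : balanced (fun x' y' => pure (x * x') (y * y')).
Proof.
split=> [x1 x2 y'|x' y1 y2|a x' y'].
- by rewrite mulrDr pureDl.
- by rewrite mulrDr pureDr.
- by rewrite mulrCA pure_scale [y * (j a * _)]mulrCA.
Qed.

Lemma mul_balanced_outer w :
  balanced (fun x y => tensor_lift (fun x' y' => pure (x * x') (y * y')) w).
Proof.
have H := mul_balanced; split=> [x1 x2 y|x y1 y2|a x y];
  elim/tensor_ind: w => [|z w IHz IHw|x' y'].
- by rewrite !tensor_lift0 ?addr0.
- by rewrite !tensor_liftD // IHz IHw addrACA.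
- by rewrite !tensor_lift_pure // mulrDl pureDl.
- by rewrite !tensor_lift0 ?addr0.
- by rewrite !tensor_liftD // IHz IHw addrACA.
- by rewrite !tensor_lift_pure // mulrDl pureDr.
- by rewrite !tensor_lift0.
- by rewrite !tensor_liftD // IHz IHw.
- by rewrite !tensor_lift_pure // -!mulrA pure_scale.
Qed.

Lemma tensor_mul_pure x y x' y' :
  tensor_mul (pure x y) (pure x' y') = pure (x * x') (y * y').
Proof.
by rewrite /tensor_mul tensor_lift_pure ?tensor_lift_pure //;
  [exact: mul_balanced|exact: mul_balanced_outer].
Qed.

Lemma tensor_mulDl : left_distributive tensor_mul +%R.
Proof.
by move=> z z' w; rewrite /tensor_mul tensor_liftD //; apply: mul_balanced_outer.
Qed.

Lemma tensor_mul0 w : tensor_mul 0 w = 0.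
Proof. by apply: (addrI (tensor_mul 0 w)); rewrite -tensor_mulDl !addr0. Qed.

Lemma tensor_mulC : commutative tensor_mul.
Proof.
have mulDr z w w' : tensor_mul z (w + w') = tensor_mul z w + tensor_mul z w'.
  elim/tensor_ind: z => [|z z' e e'|x y].
  - by rewrite !tensor_mul0 addr0.
  - by rewrite !tensor_mulDl e e' addrACA.
  - rewrite /tensor_mul !(tensor_lift_pure (mul_balanced_outer _)).
    by rewrite tensor_liftD //; apply: mul_balanced.
have mulr0 z : tensor_mul z 0 = 0.
  by apply: (addrI (tensor_mul z 0)); rewrite -mulDr !addr0.
move=> z w; elim/tensor_ind: z => [|z z' e e'|x y].
- by rewrite mulr0 tensor_mul0.
- by rewrite tensor_mulDl mulDr e e'.
elim/tensor_ind: w => [|w w' e e'|x' y'].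
- by rewrite mulr0 tensor_mul0.
- by rewrite tensor_mulDl mulDr e e'.
by rewrite !tensor_mul_pure mulrC [y * _]mulrC.
Qed.

Lemma tensor_mulDr : right_distributive tensor_mul +%R.
Proof. by move=> z w w'; rewrite !(tensor_mulC z) tensor_mulDl. Qed.

Lemma tensor_mulA : associative tensor_mul.
Proof.
have mulr0 z : tensor_mul z 0 = 0 by rewrite tensor_mulC tensor_mul0.
move=> z w v; elim/tensor_ind: z => [|z z' e e'|x y].
- by rewrite !tensor_mul0.
- by rewrite !tensor_mulDl e e'.
elim/tensor_ind: w => [|w w' e e'|x' y'].
- by rewrite !(mulr0, tensor_mul0).
- by rewrite !(tensor_mulDl, tensor_mulDr) e e'.
elim/tensor_ind: v => [|v v' e e'|x2 y2].
- by rewrite !mulr0.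
- by rewrite !tensor_mulDr e e'.
by rewrite !tensor_mul_pure !mulrA.
Qed.

Lemma tensor_mul1 : left_id tensor_one tensor_mul.
Proof.
elim/tensor_ind => [|z w e e'|x y].
- by rewrite tensor_mulC tensor_mul0.
- by rewrite tensor_mulDr e e'.
- by rewrite tensor_mul_pure !mul1r.
Qed.

HB.instance Definition _ := GRing.Zmodule_isComPzRing.Build tensor
  tensor_mulA tensor_mulC tensor_mul1 tensor_mulDl.

Lemma pureM x y x' y' : pure x y * pure x' y' = pure (x * x') (y * y').
Proof. exact: tensor_mul_pure. Qed.

Definition tensor_inl (x : K) : tensor := pure x 1.

Lemma tensor_inl_is_nmod_morphism : nmod_morphism tensor_inl.
Proof.
have D x y : tensor_inl (x + y) = tensor_inl x + tensor_inl y := pureDl x y 1.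
by split=> //; apply: (addrI (tensor_inl 0)); rewrite -D !addr0.
Qed.

Lemma tensor_inl_is_monoid_morphism : monoid_morphism tensor_inl.
Proof. by split=> // x y; rewrite /tensor_inl pureM mulr1. Qed.

HB.instance Definition _ :=
  GRing.isNmodMorphism.Build K tensor tensor_inl tensor_inl_is_nmod_morphism.
HB.instance Definition _ :=
  GRing.isMonoidMorphism.Build K tensor tensor_inl
    tensor_inl_is_monoid_morphism.

End Tensor.

(* [C] is viewed as an [A]-algebra through [f]; [tensor_inl] sends x to the
   pure tensor of x and 1. *)
Definition strong_PSI_morphism (A C : comPzRingType) (f : {rmorphism A -> C}) :
    Prop :=
  forall P : Spec A,
    (exists z : tensor (@to_residue A P) f, z != 0) ->
    bijective (@tensor_inl A (residue_field P) C (@to_residue A P) f).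

Section Subring.
Variables (B : comPzRingType) (S : subringClosed B).

Record subring := Subring { subring_val : B; subring_valP : subring_val \in S }.

HB.instance Definition _ := [isSub for subring_val].
HB.instance Definition _ := [Choice of subring by <:].
HB.instance Definition _ := 
  GRing.SubChoice_isSubComPzRing.Build B _ subring (GRing.subringClosedP S).

Variables (A : comPzRingType) (u : {rmorphism A -> B}).
Hypothesis uS : forall a, u a \in S.

(* [u] viewed as a morphism from [A] to [S]. *)
Definition corestrict (a : A) : subring := Subring (uS a).

Lemma corestrict_is_nmod_morphism : nmod_morphism corestrict.
Proof.
by split=> [|a b]; apply: (@val_inj _ _ subring); rewrite /= ?raddf0 ?raddfD.
Qed.

Lemma corestrict_is_monoid_morphism : monoid_morphism corestrict.
Proof.
by split=> [|a b]; apply: (@val_inj _ _ subring);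
  rewrite /= ?rmorph1 ?rmorphM.
Qed.

HB.instance Definition _ :=
  GRing.isNmodMorphism.Build A subring corestrict corestrict_is_nmod_morphism.
HB.instance Definition _ :=
  GRing.isMonoidMorphism.Build A subring corestrict
    corestrict_is_monoid_morphism.

End Subring.

(* [uS] says that [S] contains u(A). *)
Definition strong_PSI_subring (A B : comPzRingType) (u : {rmorphism A -> B})
    (S : subringClosed B) : Prop :=
  exists uS : forall a, u a \in S, strong_PSI_morphism (corestrict uS).

(* Main.v *)
Require Import Defs.
From mathcomp Require Import all_boot all_algebra.
From HB Require Import structures.
From mathcomp Require Import boolp.

Set Implicit Arguments.
Unset Strict Implicit.
Unset Printing Implicit Defensive.

Import GRing.Theory.
Local Open Scope ring_scope.

(** The fibre k(P) ⊗ C of A -> C at P is an algebra over the field k(P), so the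
map from k(P) to it is injective as soon as the fibre is nonzero; and it is
surjective when the fibre is zero.  Hence A -> C is a strong PSI-morphism if and
only if all the maps k(P) -> k(P) ⊗ C are surjective
([strong_PSI_morphismP]).  In this form the condition bears on one element of C
at a time: every 1 ⊗ c must come from k(P).  For a given C, the elements c with
this property form a subring, because the image of k(P) is a subring, and the
property persists when C is enlarged, because k(P) ⊗ D -> k(P) ⊗ C is
compatible with the maps from k(P) ([fibre_scalar_map]).

So let C be the subring of B generated by u(A) and by all the strong PSI
subrings of B.  Every generator of C satisfies the condition in C, hence so does
every element of C, which is therefore a strong PSI subring, and it contains all
the others by construction. *)

Section FibreScalar.
Variable A : comPzRingType.

Definition fibre_scalar (C : comPzRingType) (f : {rmorphism A -> C})
    (P : Spec A) (c : C) : Prop :=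
  exists x, tensor_inl (@to_residue A P) f x = pure (@to_residue A P) f 1 c.

(** A ring morphism from a field to a nonzero ring is injective, so only
surjectivity is at stake; over P with zero fibre it holds for free.  The pure
tensors x ⊗ c = (x ⊗ 1)(1 ⊗ c) generate the fibre, so it suffices to reach the
elements 1 ⊗ c. *)
Lemma strong_PSI_morphismP (C : comPzRingType) (f : {rmorphism A -> C}) :
  strong_PSI_morphism f <-> forall P c, fibre_scalar f P c.
Proof.
split=> [psi P c|surj P [z0 nz_z0]].
  have [nz|fibre0] := pselect (exists z : tensor (@to_residue A P) f, z != 0).
    by have [g _ gK] := psi P nz; exists (g (pure (@to_residue A P) f 1 c)).
  have all0 (z : tensor (@to_residue A P) f) : z = 0.
    by apply/eqP/negPn/negP => nz; apply: fibre0; exists z.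
  by exists 0; rewrite [LHS]all0 [RHS]all0.
pose h : {rmorphism residue_field P -> tensor (@to_residue A P) f} :=
  tensor_inl (@to_residue A P) f.
have h_onto z : exists x, h x = z.
  elim/tensor_ind: z => [|z w [x <-] [y <-]|x c].
  - by exists 0; rewrite rmorph0.
  - by exists (x + y); rewrite rmorphD.
  - have [y hy] := surj P c; exists (x * y).
    by rewrite rmorphM /= hy [tensor_inl _ _ x]/(pure _ _ x 1) pureM mulr1 mul1r.
have h_inj : injective h.
  apply: raddf_inj => x hx0; apply/eqP; apply: contraNT nz_z0 => nz_x.
  by rewrite -[z0]mulr1 -(rmorph1 h) -(mulVf nz_x) rmorphM hx0 !mulr0.
have gK : cancel (fun z => sval (cid (h_onto z))) h.
  by move=> z; case: cid.
by exists (fun z => sval (cid (h_onto z))) => //; apply: inj_can_sym gK h_inj.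
Qed.

Section Closure.
Variables (C : comPzRingType) (f : {rmorphism A -> C}) (P : Spec A).

Lemma fibre_scalar_alg a : fibre_scalar f P (f a).
Proof.
exists (to_residue P a).
by rewrite -[f a]mulr1 -pure_scale mulr1.
Qed.

Lemma fibre_scalarB c d :
  fibre_scalar f P c -> fibre_scalar f P d -> fibre_scalar f P (c - d).
Proof.
move=> [x hx] [y hy]; exists (x - y).
apply: (addIr (pure (@to_residue A P) f 1 d)).
by rewrite -pureDr subrK -hx -hy -rmorphD subrK.
Qed.

Lemma fibre_scalarM c d :
  fibre_scalar f P c -> fibre_scalar f P d -> fibre_scalar f P (c * d).
Proof.
by move=> [x hx] [y hy]; exists (x * y); rewrite rmorphM /= hx hy pureM mulr1.
Qed.

End Closure.

(** The morphism id ⊗ h from k(P) ⊗ D to k(P) ⊗ C carries an equality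
x ⊗ 1 = 1 ⊗ d to x ⊗ 1 = 1 ⊗ h(d): the same x serves for h(d). *)
Lemma fibre_scalar_map (C D : comPzRingType) (f : {rmorphism A -> C})
    (g : {rmorphism A -> D}) (h : {rmorphism D -> C}) (P : Spec A) d :
  h \o g =1 f -> fibre_scalar g P d -> fibre_scalar f P (h d).
Proof.
move=> hg [x hx]; exists x.
have bal : balanced (@to_residue A P) g
    (fun y e => pure (@to_residue A P) f y (h e)).
  split=> [y y' e|y e e'|a y e]; first exact: pureDl.
    by rewrite rmorphD pureDr.
  by rewrite pure_scale rmorphM -hg.
have := congr1
  (tensor_lift (fun y e => pure (@to_residue A P) f y (h e))) hx.
by rewrite !(tensor_lift_pure bal) rmorph1.
Qed.

End FibreScalar.

Section SubringInclusion.
Variables (B : comPzRingType) (D C : subringClosed B).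
Hypothesis sDC : {subset D <= C}.

Definition subring_incl (d : subring D) : subring C :=
  Subring (sDC (subring_valP d)).

Lemma subring_incl_is_nmod_morphism : nmod_morphism subring_incl.
Proof. by split=> [|c d]; apply: (@val_inj _ _ (subring C)). Qed.

Lemma subring_incl_is_monoid_morphism : monoid_morphism subring_incl.
Proof. by split=> [|c d]; apply: (@val_inj _ _ (subring C)). Qed.

HB.instance Definition _ := GRing.isNmodMorphism.Build
  (subring D) (subring C) subring_incl subring_incl_is_nmod_morphism.
HB.instance Definition _ := GRing.isMonoidMorphism.Build
  (subring D) (subring C) subring_incl subring_incl_is_monoid_morphism.

End SubringInclusion.

Section GeneratedSubring.
Variables (A B : comPzRingType) (u : {rmorphism A -> B}).

(** The generators include u(A), so that this subring contains u(A) without an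
appeal to the existence of a strong PSI subring. *)
Inductive PSI_generated : B -> Prop :=
| PSI_generated_alg a : PSI_generated (u a)
| PSI_generated_sub (D : subringClosed B) b :
    strong_PSI_subring u D -> b \in D -> PSI_generated b
| PSI_generatedB b c :
    PSI_generated b -> PSI_generated c -> PSI_generated (b - c)
| PSI_generatedM b c :
    PSI_generated b -> PSI_generated c -> PSI_generated (b * c).

Definition PSI_closure : {pred B} := fun b => `[< PSI_generated b >].

Lemma PSI_closureP b : reflect (PSI_generated b) (b \in PSI_closure).
Proof. exact: asboolP. Qed.

Lemma PSI_closure_subring_closed : subring_closed PSI_closure.
Proof.
split.
- by apply/PSI_closureP; rewrite -(rmorph1 u); apply: PSI_generated_alg.
- by move=> b c /PSI_closureP gb /PSI_closureP gc; apply/PSI_closureP;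
    apply: PSI_generatedB.
- by move=> b c /PSI_closureP gb /PSI_closureP gc; apply/PSI_closureP;
    apply: PSI_generatedM.
Qed.

HB.instance Definition _ :=
  GRing.isSubringClosed.Build B PSI_closure PSI_closure_subring_closed.

Lemma PSI_closure_alg a : u a \in PSI_closure.
Proof. exact/PSI_closureP/PSI_generated_alg. Qed.

Lemma sub_PSI_closure (D : subringClosed B) :
  strong_PSI_subring u D -> {subset D <= PSI_closure}.
Proof. by move=> psiD b Db; apply/PSI_closureP/(PSI_generated_sub psiD). Qed.

(** For a generator from a strong PSI subring D, the scalar found in the fibre
of D is transported along the inclusion of D; the other cases are the closure
properties of the image of k(P). *)
Lemma PSI_closure_fibre_scalar (P : Spec A) (c : subring PSI_closure) :
  fibre_scalar (corestrict PSI_closure_alg) P c.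
Proof.
(* An element of a subring is determined by its value, so each membership proof
   met in the induction can be exchanged for the one that the construction of
   the element provides. *)
have mk b (Cb : b \in PSI_closure) (d : subring PSI_closure) :
    val d = b -> Subring Cb = d by move=> e; apply: val_inj.
suff gen b : PSI_generated b -> forall Cb : b \in PSI_closure,
    fibre_scalar (corestrict PSI_closure_alg) P (Subring Cb).
  by case: c => b Cb; apply/gen/PSI_closureP.
elim=> {b c} [a|D b psiD Db|b c gb IHb gc IHc|b c gb IHb gc IHc] Cb.
- rewrite (mk _ Cb (corestrict PSI_closure_alg a)) //; exact: fibre_scalar_alg.
- have [uD /strong_PSI_morphismP scalD] := psiD.
  rewrite (mk _ Cb (subring_incl (sub_PSI_closure psiD) (Subring Db))) //.
  apply: (fibre_scalar_map _ (scalD P (Subring Db))) => a.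
  exact: val_inj.
- have /PSI_closureP Cb' := gb; have /PSI_closureP Cc' := gc.
  rewrite (mk _ Cb (Subring Cb' - Subring Cc')) //.
  exact: fibre_scalarB (IHb _) (IHc _).
- have /PSI_closureP Cb' := gb; have /PSI_closureP Cc' := gc.
  rewrite (mk _ Cb (Subring Cb' * Subring Cc')) //.
  exact: fibre_scalarM (IHb _) (IHc _).
Qed.

End GeneratedSubring.

Theorem proposition3p16 (A B : comPzRingType) (u : {rmorphism A -> B}) :
  exists2 C : subringClosed B,
    strong_PSI_subring u C
    & forall D : subringClosed B, strong_PSI_subring u D -> {subset D <= C}.
Proof.
exists (GRing.SubringClosed.clone B (PSI_closure u) _); last exact: sub_PSI_closure.
exists (PSI_closure_alg u); apply/strong_PSI_morphismP.
exact: PSI_closure_fibre_scalar.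
Qed.
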